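(* Let $(V,\nu)$ be a fuzzy antinormed linear space with respect to a t-conorm $\diamond$ satisfying $a\diamond a=a$ for all $a\in[0,1]$, and let $\alpha\in(0,1)$. Then every fuzzy $\alpha$-anti-convergent sequence in $(V,\nu)$ is a fuzzy $\alpha$-anti-Cauchy sequence in $(V,\nu)$.
   Context: $V$ is a linear space over $F$ ($F=\mathbb{R}$ or $\mathbb{C}$), and $\theta$ is its zero vector. A t-conorm is a map $\diamond:[0,1]\times[0,1]\to[0,1]$ that is commutative, associative, continuous, satisfies $a\diamond 0=a$ for all $a$, and satisfies $a\diamond b\le c\diamond d$ whenever $a\le c$, $b\le d$. A fuzzy antinorm on $V$ with respect to $\diamond$ is a function $\nu:V\times\mathbb{R}\to[0,1]$ such that for all $x,y\in V$: (i) $\nu(x,t)=1$ for all $t\le 0$; (ii) $\nu(x,t)=0$ for all $t>0$ if and only if $x=\theta$; (iii) $\nu(cx,t)=\nu(x,t/|c|)$ for all $t>0$ and $c\in F$, $c\ne 0$; (iv) $\nu(x+y,s+t)\le\nu(x,s)\diamond\nu(y,t)$ for all $s,t\in\mathbb{R}$; (v) $\lim_{t\to\infty}\nu(x,t)=0$. The pair $(V,\nu)$ is then called a fuzzy antinormed linear space with respect to $\diamond$. For $\alpha\in(0,1)$: a sequence $(x_n)$ in $V$ is fuzzy $\alpha$-anti-convergent if there exists $x\in V$ such that $\lim_{n\to\infty}\nu(x_n-x,t)<1-\alpha$ for all $t>0$; a sequence $(x_n)$ in $V$ is fuzzy $\alpha$-anti-Cauchy if $\lim_{n\to\infty}\nu(x_n-x_{n+p},t)\le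 1-\alpha$ for all $t>0$ and all $p=1,2,3,\dots$.
   Formalization: The limits as n tends to infinity in the definitions of fuzzy α-anti-convergent and fuzzy α-anti-Cauchy are read as upper limits, since the limit of ν(x_n − x_{n+p}, t) need not exist even for an α-anti-convergent sequence. *)

(* Defs.v *)
From HB Require Import structures.
From mathcomp Require Import all_boot all_order all_algebra.
From mathcomp Require Import all_classical all_reals all_analysis.
From mathcomp Require Import complex.

Set Implicit Arguments.
Unset Strict Implicit.
Unset Printing Implicit Defensive.

Import Order.TTheory GRing.Theory Num.Theory.
Import numFieldNormedType.Exports.

Local Open Scope classical_set_scope.
Local Open Scope ring_scope.

Variant scalar_kind := RealScalars | ComplexScalars.

Definition scalar_field (R : realType) (k : scalar_kind) : numFieldType :=
  match k with
  | RealScalars => R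
  | ComplexScalars => R[i]
  end.

(* On [R[i]] the norm [`|c|] is itself an element of [R[i]] (with zero
   imaginary part), hence the projection. *)
Definition modulus (R : realType) (k : scalar_kind) : scalar_field R k -> R :=
  match k return scalar_field R k -> R with
  | RealScalars => fun c : R => `|c|
  | ComplexScalars => fun c : R[i] => complex.Re `|c|
  end.

(* A t-conorm is an operation on [0, 1]; it is represented by a function on [R]
   of which only the values on [0, 1] x [0, 1] are constrained. *)
Record is_tconorm (R : realType) (op : R -> R -> R) : Prop := {
  tconorm_closed : forall a b, a \in `[0, 1] -> b \in `[0, 1] ->
    op a b \in `[0, 1];
  tconormC : forall a b, a \in `[0, 1] -> b \in `[0, 1] -> op a b = op b a;
  tconormA : forall a b c, a \in `[0, 1] -> b \in `[0, 1] -> c \in `[0, 1] ->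
    op a (op b c) = op (op a b) c;
  tconorm_continuous :
    {within (`[0, 1]%classic `*` `[0, 1]%classic : set (R * R)),
      continuous (fun p : R * R => op p.1 p.2)};
  tconorm0 : forall a, a \in `[0, 1] -> op a 0 = a;
  tconorm_le : forall a b c d,
    a \in `[0, 1] -> b \in `[0, 1] -> c \in `[0, 1] -> d \in `[0, 1] ->
    a <= c -> b <= d -> op a b <= op c d
}.

Record is_fuzzy_antinorm (R : realType) (k : scalar_kind)
    (V : lmodType (scalar_field R k)) (op : R -> R -> R) (nu : V -> R -> R) : Prop := {
  antinorm_itv : forall x t, nu x t \in `[0, 1];
  antinorm_le0 : forall x t, t <= 0 -> nu x t = 1;
  antinorm_eq0 : forall x, (forall t, 0 < t -> nu x t = 0) <-> x = 0;
  antinormZ : forall (c : scalar_field R k) x t, 0 < t -> c != 0 ->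
    nu (c *: x) t = nu x (t / modulus c);
  antinormD : forall x y s t, nu (x + y) (s + t) <= op (nu x s) (nu y t);
  antinorm_cvg0 : forall x, nu x t @[t --> +oo] --> (0 : R)
}.

(* The limits as n tends to infinity in the next two definitions are upper
   limits. An upper limit always exists and equals the limit whenever the
   sequence converges ([is_cvg_limn_esupE]). The distinction matters:
   [nu (u n - u (n + p)) t] need not converge as n tends to infinity, even if
   every [nu (u n - x) t] does, with limit smaller than [1 - alpha]. *)
Definition anti_convergent (R : realType) (k : scalar_kind)
    (V : lmodType (scalar_field R k)) (nu : V -> R -> R) (alpha : R) (u : nat -> V) :
    Prop :=
  exists x : V, forall t : R, 0 < t ->
    (limn_esup (fun n => (nu (u n - x) t)%:E) < (1 - alpha)%:E)%E.

Definition anti_cauchy (R : realType) (k : scalar_kind)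
    (V : lmodType (scalar_field R k)) (nu : V -> R -> R) (alpha : R) (u : nat -> V) :
    Prop :=
  forall (t : R) (p : nat), 0 < t -> (0 < p)%N ->
    (limn_esup (fun n => (nu (u n - u (n + p)%N) t)%:E) <= (1 - alpha)%:E)%E.

(* Main.v *)
Require Import Defs.
From HB Require Import structures.
From mathcomp Require Import all_boot all_order all_algebra.
From mathcomp Require Import all_classical all_reals all_analysis.
From mathcomp Require Import complex.

(** An idempotent t-conorm is bounded above by the maximum (it is in fact equal
to it), so the triangle inequality of the antinorm becomes ultrametric:
[nu (x + y) (s + t)] is at most the larger of [nu x s] and [nu y t]
([antinormD_max]). Suppose now that the upper limit of [nu (u n - x) (t / 2)]
is smaller than [1 - alpha]. A strict bound on an upper limit holds eventually
for the terms themselves ([limf_esup_lt_near]), hence both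
[nu (u n - x) (t / 2)] and [nu (u (n + p) - x) (t / 2)] are below [1 - alpha]
for large [n]. Splitting [u n - u (n + p)] as [(u n - x) + (x - u (n + p))] and
using the symmetry of the antinorm ([antinormN]), [nu (u n - u (n + p)) t] is
eventually below [1 - alpha], and an eventual bound passes to the upper limit. *)

Set Implicit Arguments.
Unset Strict Implicit.
Unset Printing Implicit Defensive.

Import Order.TTheory GRing.Theory Num.Theory.
Import numFieldNormedType.Exports.

Local Open Scope classical_set_scope.
Local Open Scope ring_scope.

(** The upper limit is the infimum of the suprema over the sets of the filter,
so a strict upper bound is already one for the supremum over a single set. *)
Lemma limf_esup_lt_near (R : realType) (T : choiceType) (X : filteredType T)
    (f : X -> \bar R) (F : set_system X) {FF : Filter F} (a : \bar R) :
  (limf_esup f F < a)%E -> \forall y \near F, (f y < a)%E.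
Proof.
move=> /ereal_inf_lt[_ [A FA <-] supA].
apply: filterS FA => y Ay; apply: le_lt_trans supA.
by apply: ereal_sup_ubound; exists y.
Qed.

Lemma limf_esup_le_near (R : realType) (T : choiceType) (X : filteredType T)
    (f : X -> \bar R) (F : set_system X) (a : \bar R) :
  (\forall y \near F, (f y <= a)%E) -> (limf_esup f F <= a)%E.
Proof.
move=> Fa; apply: (@le_trans _ _ (ereal_sup (f @` [set y | (f y <= a)%E]))).
  by apply: ereal_inf_lbound; exists [set y | (f y <= a)%E].
by apply: ge_ereal_sup => _ [y fya <-].
Qed.

(** With [m] the maximum of [a] and [b], monotonicity gives
[op a b <= op m m = m]. *)
Lemma tconorm_idem_le_max (R : realType) (op : R -> R -> R) (a b : R) :
  is_tconorm op -> (forall c : R, c \in `[0, 1] -> op c c = c) ->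
  a \in `[0, 1] -> b \in `[0, 1] -> op a b <= Num.max a b.
Proof.
move=> opT op_idem a01 b01.
have m01 : Num.max a b \in `[0, 1] by case: leP.
by rewrite -[leRHS]op_idem//; apply: (tconorm_le opT);
  rewrite // le_max lexx ?orbT.
Qed.

Lemma modulusN1 (R : realType) (k : scalar_kind) :
  modulus (-1 : scalar_field R k) = 1.
Proof.
case: k => /=; first exact: normrN1.
exact: (congr1 (@complex.Re R) (normrN1 R[i])).
Qed.

Lemma antinormN (R : realType) (k : scalar_kind)
    (V : lmodType (scalar_field R k)) (op : R -> R -> R) (nu : V -> R -> R)
    (x : V) (t : R) :
  is_fuzzy_antinorm op nu -> nu (- x) t = nu x t.
Proof.
move=> nuA; have [t0|t0] := leP t 0; first by rewrite !(antinorm_le0 nuA).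
by rewrite -scaleN1r (antinormZ nuA)// ?oppr_eq0 ?oner_eq0// modulusN1 divr1.
Qed.

(** Idempotence of the t-conorm turns the triangle inequality into an
ultrametric one, in which a common bound of both terms is not degraded. *)
Lemma antinormD_max (R : realType) (k : scalar_kind)
    (V : lmodType (scalar_field R k)) (op : R -> R -> R) (nu : V -> R -> R)
    (x y : V) (s t : R) :
  is_tconorm op -> (forall c : R, c \in `[0, 1] -> op c c = c) ->
  is_fuzzy_antinorm op nu ->
  nu (x + y) (s + t) <= Num.max (nu x s) (nu y t).
Proof.
move=> opT op_idem nuA; apply: le_trans (antinormD nuA x y s t) _.
by apply: tconorm_idem_le_max => //; exact: antinorm_itv nuA _ _.
Qed.

Theorem theorem4p6 (R : realType) (k : scalar_kind)
    (V : lmodType (scalar_field R k)) (op : R -> R -> R) (nu : V -> R -> R)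
    (op_tconorm : is_tconorm op)
    (nu_antinorm : is_fuzzy_antinorm op nu)
    (op_idem : forall a : R, a \in `[0, 1] -> op a a = a)
    (alpha : R) (alpha_gt0 : 0 < alpha) (alpha_lt1 : alpha < 1)
    (u : nat -> V) :
  anti_convergent nu alpha u -> anti_cauchy nu alpha u.
Proof.
move=> [x ux] t p t0 _.
have t20 : 0 < t / 2 by rewrite divr_gt0.
have u_near : \forall n \near \oo, nu (u n - x) (t / 2) < 1 - alpha.
  by apply: limf_esup_lt_near (ux _ t20); exact: eventually_filter.
have up_near : \forall n \near \oo, nu (u (n + p)%N - x) (t / 2) < 1 - alpha.
  have [N _ uN] := u_near; exists N => // n Nn.
  by apply: uN; exact: leq_trans Nn (leq_addr _ _).
suff nu_le : \forall n \near \oo, nu (u n - u (n + p)%N) t <= 1 - alpha.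
  by apply: limf_esup_le_near; exact: nu_le.
apply: filterS2 u_near up_near => n un_lt unp_lt.
rewrite -(subrKA x) [in leLHS](splitr t).
apply: le_trans (antinormD_max _ _ _ _ op_tconorm op_idem nu_antinorm) _.
by rewrite -[x - u (n + p)%N]opprB (antinormN _ _ nu_antinorm) ge_max !ltW.
Qed.
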